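(* Let $(\Omega,\mathcal F,\mathbb P)$ be a nonatomic probability space. Fix $1\le p\le\infty$ and let $\mathcal A\subset L^p$ be a closed, convex acceptance set with nonempty interior. Consider a traded asset $S=(S_0,S_T)$ with pricing functional $\pi$. If $\rho_{\mathcal A,S,\pi}$ is cash subadditive and $\rho_{\mathcal A,S}(0)\in\mathbb R$, then $\pi$ is continuous.
   Context: $L^p=L^p(\Omega,\mathcal F,\mathbb P)$ with its usual norm topology and the almost sure order, positive cone $L^p_+$. An acceptance set is a nonempty proper subset $\mathcal A\subset L^p$ such that $X\in\mathcal A$ and $Y\ge X$ imply $Y\in\mathcal A$. A traded asset is a pair $S=(S_0,S_T)$ with $S_0>0$ real and $S_T\in L^p_+$ nonzero. A pricing functional for $S$ is a strictly increasing function $\pi:\mathbb R\to\mathbb R$ (a priori not necessarily continuous) with $\pi(0)=0$ and $\pi(1)=S_0$. Define, with $\inf\emptyset=\infty$, $$\rho_{\mathcal A,S}(X)=\inf\{m\in\mathbb R : X+\tfrac{m}{S_0}S_T\in\mathcal A\},\qquad \rho_{\mathcal A,S,\pi}(X)=\inf\{\pi(\lambda) : \lambda\in\mathbb R,\ X+\lambda S_T\in\mathcal A\}.$$ A function $\rho:L^p\to\mathbb R\cup\{\pm\infty\}$ is cash subadditive if it is decreasing ($X\le Y$ implies $\rho(X)\ge\rho(Y)$) and $\rho(X+\lambda 1_\Omega)\ge\rho(X)-\lambda$ for all $\lambda>0$ and $X\in L^p$. *)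

(* Defs.v *)
From HB Require Import structures.
From mathcomp Require Import all_boot all_order all_algebra.
From mathcomp Require Import all_classical all_reals all_analysis.
From mathcomp Require Import measurable_realfun ess_sup_inf.

Set Implicit Arguments.
Unset Strict Implicit.
Unset Printing Implicit Defensive.
Import Order.TTheory GRing.Theory Num.Theory.
Import numFieldNormedType.Exports.
Local Open Scope classical_set_scope.
Local Open Scope ring_scope.

(* The library's LspaceType mu p1 is L^p(mu) as a set of a.e.-equality classes
   of measurable functions; it comes without any structure. We equip it with its
   vector space structure and with the norm 'N[mu]_p, so that the topological
   notions on it (closed, interior, ...) are those of the norm topology.
   An element coerces to a function through a chosen representative. *)
Section Lspace_normed.
Context d (T : measurableType d) (R : realType).
Variable mu : {measure set T -> \bar R}.
Variables (p : \bar R) (p1 : (1 <= p)%E).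
Local Open Scope quotient_scope.
Notation Lfn := (LfunType mu p1).
Notation Lsp := (LspaceType mu p1).
Notation Q := {mfun_ mu, T >-> measurableTypeR R}.

Lemma LspaceType_Lfun (x : Lsp) : ((x : T -> R) : T -> R) \in Lfun mu p.
Proof.
rewrite inE; apply/andP; split; rewrite inE /=.
  exact: (@measurable_funPT _ _ _ _ (repr (x : Q))).
exact: Lebesgue_finite.
Qed.

Definition Lspace_repr (x : Lsp) : Lfn := Lfun_Sub p1 (LspaceType_Lfun x).

Lemma Lfun_mfun_subproof (f : Lfn) : (f : T -> measurableTypeR R) \in mfun.
Proof. by rewrite inE /=; exact: (@measurable_funPT _ _ _ _ f). Qed.

Definition Lfun_class (f : Lfn) : Q := \pi_Q (mfun_Sub (Lfun_mfun_subproof f)).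

Lemma Lfun_classE (f : Lfn) : (Lfun_class f : T -> R) = f %[ae mu].
Proof.
have /eqP : repr (Lfun_class f) = mfun_Sub (Lfun_mfun_subproof f) %[mod Q].
  by rewrite reprK.
by rewrite eqmodE => /asboolP.
Qed.

Lemma ae_eq_Lnorm (f g : T -> R) :
  measurable_fun setT f -> measurable_fun setT g ->
  f = g %[ae mu] -> 'N[mu]_p[EFin \o f]%E = 'N[mu]_p[EFin \o g]%E.
Proof.
move=> mf mg fg; rewrite unlock /Lnorm; case: p p1 => [r r1| |//].
  have mN (h : T -> R) : measurable_fun setT h ->
      measurable_fun setT ((fun y : \bar R => (y `^ r)%E) \o
        (abse \o (EFin \o h)) : T -> \bar R).
    move=> mh; apply: (measurableT_comp (measurable_poweR _)).
    by apply: measurableT_comp => //; exact/measurable_EFinP.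
  congr (_ `^ _)%E; apply: ae_eq_integral => //; [exact: mN|exact: mN|].
  by apply: filterS fg => x /= + _ => /(_ I) ->.
move=> _; case: ifPn => // mu0; apply: eq_ess_sup.
by apply: filterS fg => x /= /(_ I) ->.
Qed.

Lemma Lfun_class_finite (f : Lfn) : finite_norm mu p (Lfun_class f).
Proof.
rewrite /finite_norm (@ae_eq_Lnorm _ f) //.
- exact: Lfunction_finite.
- exact: (@measurable_funPT _ _ _ _ (repr (Lfun_class f))).
- exact: Lfun_classE.
Qed.

HB.instance Definition _ (f : Lfn) :=
  @isFinLebesgue.Build d T R mu p p1 (Lfun_class f) (Lfun_class_finite f).

Definition to_Lspace (f : Lfn) : Lsp := Lfun_class f.

Lemma to_LspaceE (f : Lfn) : (to_Lspace f : T -> R) = f %[ae mu].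
Proof. exact: Lfun_classE. Qed.

Lemma Lspace_val_inj (x y : Lsp) : (x : Q) = (y : Q) -> x = y.
Proof.
case: x y => [f [[hf]]] [g [[hg]]] /= fg; subst g.
by congr LebesgueSpace.Pack; congr LebesgueSpace.Class;
  congr isFinLebesgue.Axioms_.
Qed.

Lemma Lspace_eqP (x y : Lsp) : x = y <-> (x : T -> R) = y %[ae mu].
Proof.
split=> [->|/asboolP xy]; first exact: aeW.
apply: Lspace_val_inj; rewrite -[LHS]reprK -[RHS]reprK.
by apply/eqP; rewrite eqmodE.
Qed.

Lemma to_Lspace_eq (f g : Lfn) :
  (f : T -> R) = g %[ae mu] -> to_Lspace f = to_Lspace g.
Proof.
move=> fg; apply/Lspace_eqP.
by near=> t => _; rewrite (near (to_LspaceE f) t)// (near (to_LspaceE g) t)//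
  (near fg t).
Unshelve. all: by end_near. Qed.

Lemma Lspace_reprK (x : Lsp) : to_Lspace (Lspace_repr x) = x.
Proof. by apply/Lspace_eqP; exact: to_LspaceE. Qed.

HB.instance Definition _ := gen_eqMixin Lsp.
HB.instance Definition _ := gen_choiceMixin Lsp.

Definition Lspace_zero : Lsp := to_Lspace 0.
Definition Lspace_opp (x : Lsp) : Lsp := to_Lspace (- Lspace_repr x).
Definition Lspace_add (x y : Lsp) : Lsp :=
  to_Lspace (Lspace_repr x + Lspace_repr y).
Definition Lspace_scale (a : R) (x : Lsp) : Lsp :=
  to_Lspace (a *: Lspace_repr x).

Lemma to_LspaceD_subproof (f g : Lfn) :
  to_Lspace (f + g) = Lspace_add (to_Lspace f) (to_Lspace g).
Proof.
apply: to_Lspace_eq; near=> t => _ /=.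
by congr (_ + _); rewrite (near (to_LspaceE _) t).
Unshelve. all: by end_near. Qed.

Lemma to_LspaceN_subproof (f : Lfn) :
  to_Lspace (- f) = Lspace_opp (to_Lspace f).
Proof.
apply: to_Lspace_eq; near=> t => _ /=.
by congr (- _); rewrite (near (to_LspaceE _) t).
Unshelve. all: by end_near. Qed.

Lemma to_LspaceZ_subproof a (f : Lfn) :
  to_Lspace (a *: f) = Lspace_scale a (to_Lspace f).
Proof.
apply: to_Lspace_eq; near=> t => _ /=.
by congr (_ * _); rewrite (near (to_LspaceE _) t).
Unshelve. all: by end_near. Qed.

Lemma Lspace_addA : associative Lspace_add.
Proof.
move=> x y z; rewrite -(Lspace_reprK x) -(Lspace_reprK y) -(Lspace_reprK z).
by rewrite -!to_LspaceD_subproof addrA.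
Qed.

Lemma Lspace_addC : commutative Lspace_add.
Proof.
move=> x y; rewrite -(Lspace_reprK x) -(Lspace_reprK y).
by rewrite -!to_LspaceD_subproof addrC.
Qed.

Lemma Lspace_add0 : left_id Lspace_zero Lspace_add.
Proof. by move=> x; rewrite -(Lspace_reprK x) -to_LspaceD_subproof add0r. Qed.

Lemma Lspace_addN : left_inverse Lspace_zero Lspace_opp Lspace_add.
Proof.
move=> x; rewrite -(Lspace_reprK x).
by rewrite -to_LspaceN_subproof -to_LspaceD_subproof addNr.
Qed.

HB.instance Definition _ := GRing.isZmodule.Build Lsp
  Lspace_addA Lspace_addC Lspace_add0 Lspace_addN.

Lemma to_LspaceD : {morph to_Lspace : f g / f + g}.
Proof. exact: to_LspaceD_subproof. Qed.

Lemma to_LspaceN : {morph to_Lspace : f / - f}.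
Proof. exact: to_LspaceN_subproof. Qed.

Lemma Lspace_scaleA a b (x : Lsp) :
  Lspace_scale a (Lspace_scale b x) = Lspace_scale (a * b) x.
Proof. by rewrite -(Lspace_reprK x) -!to_LspaceZ_subproof scalerA. Qed.

Lemma Lspace_scale1 : left_id 1 Lspace_scale.
Proof. by move=> x; rewrite -(Lspace_reprK x) -to_LspaceZ_subproof scale1r. Qed.

Lemma Lspace_scaleDr : right_distributive Lspace_scale +%R.
Proof.
move=> a x y; rewrite -(Lspace_reprK x) -(Lspace_reprK y).
by rewrite -to_LspaceD -!to_LspaceZ_subproof -to_LspaceD scalerDr.
Qed.

Lemma Lspace_scaleDl (x : Lsp) : {morph Lspace_scale^~ x : a b / a + b}.
Proof.
move=> a b; rewrite -(Lspace_reprK x).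
by rewrite -!to_LspaceZ_subproof -to_LspaceD scalerDl.
Qed.

HB.instance Definition _ := GRing.Zmodule_isLmodule.Build R Lsp
  Lspace_scaleA Lspace_scale1 Lspace_scaleDr Lspace_scaleDl.

Lemma to_LspaceZ a : {morph to_Lspace : f / a *: f}.
Proof. exact: to_LspaceZ_subproof. Qed.

Definition Lspace_norm (x : Lsp) : R := fine 'N[mu]_p[EFin \o (x : T -> R)]%E.

Lemma Lspace_norm_to (f : Lfn) :
  Lspace_norm (to_Lspace f) = fine 'N[mu]_p[EFin \o (f : T -> R)]%E.
Proof.
rewrite /Lspace_norm (@ae_eq_Lnorm _ f) //; last exact: to_LspaceE.
exact: (@measurable_funPT _ _ _ _ (repr (to_Lspace f : Q))).
Qed.

Lemma ler_Lspace_normD (x y : Lsp) :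
  Lspace_norm (x + y) <= Lspace_norm x + Lspace_norm y.
Proof.
rewrite -(Lspace_reprK x) -(Lspace_reprK y) -to_LspaceD.
by rewrite !Lspace_norm_to; exact: ler_LnormD.
Qed.

Lemma Lspace_normZ (a : R) (x : Lsp) :
  Lspace_norm (a *: x) = `|a| * Lspace_norm x.
Proof.
rewrite -(Lspace_reprK x) -to_LspaceZ !Lspace_norm_to.
by apply: EFin_inj; rewrite EFinM !finite_norm_fine LnormZ.
Qed.

Lemma Lspace_norm0_eq0 (x : Lsp) : Lspace_norm x = 0 -> x = 0.
Proof.
rewrite -(Lspace_reprK x) Lspace_norm_to => /fine_Lnormr_eq0 h.
exact: to_Lspace_eq.
Qed.

HB.instance Definition _ := Lmodule_isNormed.Build R Lsp
  ler_Lspace_normD Lspace_normZ Lspace_norm0_eq0.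

Lemma Lspace_normE (x : Lsp) :
  (`|x|)%:E = 'N[mu]_p[EFin \o (x : T -> R)]%E.
Proof. exact: (finite_norm_fine (Lspace_repr x)). Qed.

Lemma Lspace_addE (x y : Lsp) :
  (x + y : T -> R) = (x : T -> R) \+ (y : T -> R) %[ae mu].
Proof. exact: (to_LspaceE (Lspace_repr x + Lspace_repr y)). Qed.

Lemma Lspace_scaleE (a : R) (x : Lsp) :
  (a *: x : T -> R) = a \*: (x : T -> R) %[ae mu].
Proof. exact: (to_LspaceE (a *: Lspace_repr x)). Qed.

End Lspace_normed.

Arguments to_Lspace {d T R mu p p1}.
Arguments Lspace_repr {d T R mu p p1}.

Definition nonatomic d (T : measurableType d) (R : realType)
    (mu : {measure set T -> \bar R}) : Prop :=
  forall A : set T, measurable A -> (0 < mu A)%E ->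
    exists B : set T,
      [/\ measurable B, B `<=` A, (0 < mu B)%E & (mu B < mu A)%E].

Section acceptance.
Context d (T : measurableType d) (R : realType) (P : probability T R).
Variables (p : \bar R) (p1 : (1 <= p)%E).
Notation Lsp := (LspaceType P p1).

Lemma Lfun_prob_cst (c : R) : (cst c : T -> R) \in Lfun P p.
Proof.
have P0 : (0 < P [set: T])%E by rewrite probability_setT lte01.
have : (cst c : T -> R) \in Lfun P +oo%E.
  rewrite inE; apply/andP; split; rewrite inE //=.
  rewrite /finite_norm unlock /Lnorm P0.
  by rewrite (_ : _ \o _ = cst `|c|%:E)// ess_sup_cst// ltry.
by apply: Lfun_subset => //; rewrite ?leey// ?fin_num_measure//.
Qed.

Definition Lspace_cst (c : R) : Lsp :=
  to_Lspace (Lfun_Sub p1 (Lfun_prob_cst c)).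

Lemma Lspace_cstE (c : R) : (Lspace_cst c : T -> R) = cst c %[ae P].
Proof. exact: to_LspaceE. Qed.

(* Independent of the chosen representatives. *)
Definition Lspace_le (X Y : Lsp) : Prop :=
  \forall t \ae P, (X : T -> R) t <= (Y : T -> R) t.

Definition acceptance_set (A : set Lsp) : Prop :=
  [/\ A !=set0, A != setT & forall X Y, A X -> Lspace_le X Y -> A Y].

Record traded_asset := TradedAsset {
  asset_price : R ;
  asset_payoff : Lsp ;
  asset_price_gt0 : 0 < asset_price ;
  asset_payoff_ge0 : Lspace_le 0 asset_payoff ;
  asset_payoff_neq0 : asset_payoff != 0
}.

Definition pricing_functional (S : traded_asset) (f : R -> R) : Prop :=
  [/\ {homo f : x y / x < y}, f 0 = 0 & f 1 = asset_price S].

(* ereal_inf set0 = +oo *)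
Definition rho (A : set Lsp) (S : traded_asset) (X : Lsp) : \bar R :=
  ereal_inf [set m%:E | m in
    [set m : R | A (X + (m / asset_price S) *: asset_payoff S)]].

Definition rho_pricing (A : set Lsp) (S : traded_asset) (f : R -> R)
    (X : Lsp) : \bar R :=
  ereal_inf [set (f l)%:E | l in [set l : R | A (X + l *: asset_payoff S)]].

Definition cash_subadditive (r : Lsp -> \bar R) : Prop :=
  (forall X Y, Lspace_le X Y -> (r Y <= r X)%E) /\
  (forall (l : R) X, 0 < l -> (r X - l%:E <= r (X + Lspace_cst l)%R)%E).

End acceptance.

(* Main.v *)
(* Write S for the payoff of the asset. The idea is to find Y in A and constants
   c, dl > 0 such that Y - eps S is not in A for any eps > 0, while
   Y + t c - t dl S is in A for all t in [0, 1]. Cash subadditivity between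
   Y - x S and Y - x S + t c then gives f x - t c <= f (x - t dl) for every x,
   so the increasing function f is locally Lipschitz.
   To get Y, slide an interior point Y0 of A along -S until it leaves A; it does
   leave A, since otherwise -S would be a recession direction of the closed
   convex set A, against the finiteness of rho at 0. So Y0 = Y + eps S is
   interior, and so A still contains Y + eps W - dl S when W is a bounded
   approximation of S in L^p and dl is small; finally eps W is below a constant,
   and convexity gives the whole segment. *)
Require Import Defs.
From mathcomp Require Import all_boot all_order all_algebra.
From mathcomp Require Import all_classical all_reals all_analysis.
From mathcomp Require Import measurable_realfun ess_sup_inf lra.
Set Implicit Arguments.
Unset Strict Implicit.
Unset Printing Implicit Defensive.
Import Order.TTheory GRing.Theory Num.Theory.
Import numFieldNormedType.Exports.
Local Open Scope classical_set_scope.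
Local Open Scope ring_scope.

(** * Closed convex sets in a normed space *)

Lemma closed_norm_approx (R : realType) (V : normedModType R) (A : set V) (x : V) :
  closed A -> (forall e, 0 < e -> exists2 y, A y & `|x - y| < e) -> A x.
Proof.
move=> clA h; apply: clA => B /nbhs_normP[e /= e0 eB].
by have [y Ay xy] := h e e0; exists y; split=> //; exact: eB.
Qed.

Lemma convex_set_segment (R : realType) (V : lmodType R) (A : set V) (x y : V) (t : R) :
  convex_set (A : set (convex_lmodType V)) -> A x -> A y -> 0 <= t <= 1 ->
  A (x + t *: (y - x)).
Proof.
move=> cA Ax Ay t01.
have tI : Itv.spec (@Itv.num_sem R) (Itv.Real `[0%Z, 1%Z]%R) t.
  rewrite /= /Itv.num_sem /= num_real /=.
  by rewrite in_itv /=.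
have /set_mem := cA y x (Itv.mk tI) (mem_set Ay) (mem_set Ax).
rewrite [X in A X](_ : _ = x + t *: (y - x)) //.
rewrite [LHS]/conv /= /unstable.onem scalerBl scale1r scalerBr.
by rewrite addrC addrA addrAC.
Qed.

(** The segment from [z] to the far point [y + (l / t) *: v] meets [A] at
    [z + l *: v + t *: (y - z)], which tends to [z + l *: v] as [t] tends to 0; closedness gives the
    limit. *)
Lemma closed_convex_recession (R : realType) (V : normedModType R)
    (A : set V) (y z v : V) :
  closed A -> convex_set (A : set (convex_lmodType V)) ->
  (forall l, A (y + l *: v)) -> A z -> forall l, A (z + l *: v).
Proof.
move=> clA cA Ay Az l; apply: closed_norm_approx clA _ => e e0.
(* The added 1 in the denominator allows [y = z] and makes the final bound by [e] strict. *)
pose t := Num.min 1 (e / (1 + `|y - z|)).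
have N0 : 0 < 1 + `|y - z| by rewrite ltr_pwDl.
have t0 : 0 < t by rewrite lt_min ltr01 divr_gt0.
have t1 : t <= 1 by rewrite ge_min lexx.
exists (z + t *: (y + (l / t) *: v - z)).
  by apply: convex_set_segment => //; rewrite (ltW t0).
rewrite (_ : _ - _ = t *: (z - y)); last first.
  have -> : t *: (y + (l / t) *: v - z) = t *: (y - z) + l *: v.
    by rewrite addrAC scalerDr scalerA mulrCA divff ?gt_eqF// mulr1.
  rewrite opprD addrACA subrr add0r opprD addrCA subrr addr0.
  by rewrite -scalerN opprB.
rewrite normrZ gtr0_norm// distrC.
have : t <= e / (1 + `|y - z|) by rewrite ge_min lexx orbT.
rewrite ler_pdivlMr// => te.
by apply: lt_le_trans te; rewrite ltr_pM2l// ltrDr.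
Qed.

(** * The almost sure order and approximation by elements bounded above *)

Section Lspace_order.
Context d (T : measurableType d) (R : realType) (P : probability T R).
Variables (p : \bar R) (p1 : (1 <= p)%E).
Notation Lsp := (LspaceType P p1).

Lemma Lspace_leDl (X Y Z : Lsp) : Lspace_le Y Z -> Lspace_le (X + Y) (X + Z).
Proof.
move=> YZ; rewrite /Lspace_le; near=> t.
rewrite (near (Lspace_addE X Y) t)// (near (Lspace_addE X Z) t)//= lerD2l.
by near: t.
Unshelve. all: by end_near. Qed.

Lemma Lspace_leZ (a : R) (X Y : Lsp) :
  0 <= a -> Lspace_le X Y -> Lspace_le (a *: X) (a *: Y).
Proof.
move=> a0 XY; rewrite /Lspace_le; near=> t.
rewrite (near (Lspace_scaleE a X) t)// (near (Lspace_scaleE a Y) t)//=.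
rewrite ler_wpM2l//.
by near: t.
Unshelve. all: by end_near. Qed.

Lemma Lspace_leT (X Y Z : Lsp) : Lspace_le X Y -> Lspace_le Y Z -> Lspace_le X Z.
Proof.
move=> XY YZ; rewrite /Lspace_le; near=> t.
by apply: (@le_trans _ _ ((Y : T -> R) t)); near: t.
Unshelve. all: by end_near. Qed.

Lemma Lspace_cstZ (a c : R) : a *: Lspace_cst P p1 c = Lspace_cst P p1 (a * c).
Proof.
apply/Lspace_eqP; near=> t => _.
rewrite (near (Lspace_scaleE a (Lspace_cst P p1 c)) t)//=.
by rewrite (near (Lspace_cstE P p1 c) t)// (near (Lspace_cstE P p1 (a * c)) t).
Unshelve. all: by end_near. Qed.

Lemma Lspace_cst_le (a b : R) : a <= b ->
  Lspace_le (Lspace_cst P p1 a) (Lspace_cst P p1 b).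
Proof.
move=> ab; rewrite /Lspace_le; near=> t.
by rewrite (near (Lspace_cstE P p1 a) t)// (near (Lspace_cstE P p1 b) t).
Unshelve. all: by end_near. Qed.

End Lspace_order.

(* The truncation error [max (X - n) 0] tends to 0 in L^r by dominated
   convergence. *)
Lemma Lspace_bounded_approx_fin d (T : measurableType d) (R : realType)
    (P : probability T R) (r : R) (p1 : (1 <= r%:E)%E) (X : LspaceType P p1)
    (e : R) : 0 < e ->
  exists V c, Lspace_le V (Lspace_cst P p1 c) /\ `|X - V| < e.
Proof.
move=> e0.
have r0 : 0 < r by rewrite (lt_le_trans ltr01)// -lee_fin.
have mX : measurable_fun setT (X : T -> R).
  exact: (@measurable_funPT _ _ _ _ (Lspace_repr X)).
pose D n : T -> R := fun t => Num.max ((X : T -> R) t - n%:R) 0.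
have mD n : measurable_fun setT (D n).
  by apply: measurable_maxr => //; exact: measurable_funB.
have DX n t : `|D n t| <= `|(X : T -> R) t|.
  rewrite /D ger0_norm ?le_max ?lexx ?orbT// ge_max normr_ge0 andbT.
  by rewrite (le_trans _ (ler_norm _))// gerBl.
have intX : P.-integrable setT (fun t => (`|(X : T -> R) t| `^ r)%:E).
  by apply: Lfun_integrable; [rewrite -lee_fin|exact: LspaceType_Lfun].
have mDr n : measurable_fun setT (fun t => (`|D n t| `^ r)%:E).
  apply/measurable_EFinP.
  apply: (@measurableT_comp _ _ _ _ _ _ (fun x : R => x `^ r)) => //.
  exact: measurableT_comp.
have DLfun n : D n \in Lfun P r%:E.
  rewrite inE; apply/andP; split; rewrite inE //=.
  rewrite /finite_norm unlock /=; apply: poweR_lty.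
  have /integrableP[_] := intX; apply: le_lt_trans.
  apply: ge0_le_integral => //.
  - by apply: measurableT_comp => //; have /integrableP[] := intX.
  - move=> t _; rewrite gee0_abs ?lee_fin ?powR_ge0//.
    by apply: ge0_ler_powR; rewrite ?nnegrE// ltW.
pose E n : LspaceType P p1 := to_Lspace (Lfun_Sub p1 (DLfun n)).
have normE n : (`|E n| `^ r)%:E = (\int[P]_t (`|D n t| `^ r)%:E)%E.
  rewrite -poweR_EFin.
  have -> : `|E n|%:E = 'N[P]_r%:E[EFin \o D n]%E.
    by rewrite [`|E n|]Lspace_norm_to finite_norm_fine.
  by rewrite poweR_Lnorm ?gt_eqF.
have Dcvg : (\int[P]_t (`|D n t| `^ r)%:E)%E @[n --> \oo] --> 0%E.
  rewrite -[X in _ --> X](@integral0 _ _ _ P setT).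
  apply: (@dominated_cvg _ _ _ _ _ _ _ _ (fun t => (`|(X : T -> R) t| `^ r)%:E)) => //.
  (* Pointwise, [D n t] vanishes as soon as [n] exceeds the value of [X] at [t]. *)
  - move=> t _; apply: cvg_near_cst; near=> n.
    rewrite /D max_r ?normr0 ?powR0 ?gt_eqF// subr_le0.
    near: n; exact: nbhs_infty_ger.
  - move=> n t _; rewrite gee0_abs ?lee_fin ?powR_ge0//.
    by apply: ge0_ler_powR; rewrite ?nnegrE// ltW.
have er0 : 0 < e `^ r by rewrite powR_gt0.
have [n _ nP] := Dcvg _ (open_ereal_lt' (er0 : (0%E < (e `^ r)%:E)%E)).
have {}nP : `|E n| `^ r < e `^ r.
  by rewrite -lte_fin normE; apply: nP => /=.
(* [X - E n] is the truncation [min X n], hence bounded above by [n]. *)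
exists (X - E n), n%:R; split; last first.
  rewrite opprB addrC addrNK.
  rewrite ltNge; apply/negP => eE; move: nP; apply/negP; rewrite -leNgt.
  by apply: ge0_ler_powR; rewrite ?nnegrE// ltW.
rewrite /Lspace_le; near=> t.
rewrite (near (Lspace_cstE P p1 n%:R) t)//.
have -> : X - E n = X + (-1) *: E n by rewrite scaleN1r.
rewrite (near (Lspace_addE X ((-1) *: E n)) t)//=.
rewrite (near (Lspace_scaleE (-1) (E n)) t)//=.
rewrite (near (to_LspaceE (Lfun_Sub p1 (DLfun n))) t)//=.
have -> : -1 *: D n t = - D n t by exact: mulN1r.
rewrite lerBlDr -lerBlDl le_max lexx//.
Unshelve. all: by end_near. Qed.

(** Truncation settles finite [p]; for [p = +oo], [X] is itself almost surely below its norm, an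
    essential supremum. *)
Lemma Lspace_bounded_approx d (T : measurableType d) (R : realType)
    (P : probability T R) (p : \bar R) (p1 : (1 <= p)%E) (X : LspaceType P p1)
    (e : R) : 0 < e ->
  exists V c, Lspace_le V (Lspace_cst P p1 c) /\ `|X - V| < e.
Proof.
case: p p1 X => [r| |//] p1 X e0; first exact: Lspace_bounded_approx_fin.
exists X, `|X|; rewrite subrr normr0; split=> //.
have normX : (`|X|)%:E = ess_sup P (abse \o (EFin \o (X : T -> R))).
  by rewrite Lspace_normE unlock /= probability_setT lte01.
rewrite /Lspace_le; near=> t.
rewrite (near (Lspace_cstE P p1 `|X|) t)// (le_trans (ler_norm _))//.
rewrite -lee_fin normX.
by near: t; exact: ess_sup_ge.
Unshelve. all: by end_near. Qed.

(** * Sliding along a line until it leaves the set *)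

(** The admissible parameters form an up-closed set. Were it unbounded below, the whole line through
    [y] would lie in [A], and by recession so would the line through [z], against the bound [b].
    Closedness makes the infimum attained. *)
Lemma closed_convex_line_min (R : realType) (V : normedModType R)
    (A : set V) (y z v : V) (b : R) :
  closed A -> convex_set (A : set (convex_lmodType V)) ->
  (forall x l, A x -> 0 <= l -> A (x + l *: v)) ->
  A y -> A z -> (forall l, A (z + l *: v) -> b <= l) ->
  exists2 l0, A (y + l0 *: v) & forall l, A (y + l *: v) -> l0 <= l.
Proof.
move=> clA cA upA Ay Az zb.
pose L := [set l : R | A (y + l *: v)].
have L0 : L !=set0 by exists 0; rewrite /L /= scale0r addr0.
have upL l l' : l <= l' -> L l -> L l'.
  move=> ll' Ll; rewrite /L /= (_ : y + _ = y + l *: v + (l' - l) *: v).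
    by apply: upA => //; rewrite subr_ge0.
  by rewrite -addrA -scalerDl [l + _]addrC subrK.
have lbL : has_lbound L.
  apply/not_existsP => nb.
  have : A (z + (b - 1) *: v).
    apply: (@closed_convex_recession _ _ A y z) => // l.
    have /existsNP[l' /not_implyP[Ll' /negP]] := nb l.
    by rewrite -ltNge => /ltW /upL; exact.
  by move=> /zb; rewrite lerBrDl gerDr ler10.
have infL : has_inf L by [].
exists (inf L); last by move=> l Ll; exact: ge_inf.
apply: closed_norm_approx clA _ => e e0.
have v0 : 0 < 1 + `|v| by rewrite ltr_pwDl.
have [l Ll] := inf_adherent (divr_gt0 e0 v0) infL.
rewrite -ltrBlDl => il; exists (y + l *: v) => //.
have /ge_inf -/(_ lbL) il' := Ll.
rewrite opprD addrACA subrr add0r -scalerBl normrZ distrC ger0_norm ?subr_ge0//.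
move: il; rewrite ltr_pdivlMr//; apply: le_lt_trans.
by rewrite ler_wpM2l ?subr_ge0// lerDr.
Qed.

(** * A boundary point of the acceptance set *)

Section acceptance_boundary.
Context d (T : measurableType d) (R : realType) (P : probability T R).
Variables (p : \bar R) (p1 : (1 <= p)%E) (A : set (LspaceType P p1)).
Variable S : traded_asset P p1.
Hypothesis hA : acceptance_set A.
Notation V := (asset_payoff S).

Lemma acceptance_setD_payoff X l : A X -> 0 <= l -> A (X + l *: V).
Proof.
move=> AX l0; have [_ _ mono] := hA; apply: (mono X) => //.
rewrite -[X in Lspace_le X _]addr0; apply: Lspace_leDl.
rewrite -[X in Lspace_le X _](scaler0 _ l); apply: Lspace_leZ => //.
exact: asset_payoff_ge0.
Qed.

(** A finite infimum has a competitor [m], which gives [Z], and a lower bound on all competitors,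
    which becomes [b] after division by the asset price. *)
Lemma rho0_fin_num_line : rho A S 0 \is a fin_num ->
  exists Z b, A Z /\ forall l, A (Z + l *: V) -> b <= l.
Proof.
move=> hfin; have S0 := asset_price_gt0 S.
have [_ [m /= Am <-] _] := lb_ereal_inf_adherent ltr01 hfin.
exists (0 + (m / asset_price S) *: V).
exists ((fine (rho A S 0) - m) / asset_price S); split=> // l Al.
rewrite ler_pdivrMr// lerBlDl -lee_fin fineK//.
apply: ereal_inf_lbound; exists (m + l * asset_price S) => //=.
by rewrite mulrDl mulfK ?gt_eqF// scalerDl addrA.
Qed.

Hypotheses (Aclosed : closed A)
  (Aconvex : convex_set (A : set (convex_lmodType (LspaceType P p1))))
  (Aint : interior A !=set0).

Lemma acceptance_boundary : rho A S 0 \is a fin_num ->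
  exists Y c dl, [/\ 0 < c, 0 < dl, A Y,
    forall l, A (Y + l *: V) -> 0 <= l &
    A (Y + Lspace_cst P p1 c - dl *: V)].
Proof.
move=> /rho0_fin_num_line[Z [b [AZ Zb]]]; have [Y0 intY0] := Aint.
have AY0 : A Y0 := interior_subset intY0.
have [l0 AY l0min] := closed_convex_line_min Aclosed Aconvex
  acceptance_setD_payoff AY0 AZ Zb.
have l0le : l0 <= 0 by apply: l0min; rewrite scale0r addr0.
have [r r0 rA] : exists2 r, 0 < r & forall X, `|Y0 - X| < r -> A X.
  by move: intY0 => /nbhs_normP[r /= r0 rA]; exists r.
pose eps := - l0; have eps0 : 0 <= eps by rewrite oppr_ge0.
have r2 : 0 < r / 2 by rewrite divr_gt0.
(* The radius [r] is split in two: [eps *: (V - W)] has norm below [r / 2], and [dl *: V] norm at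
   most [r / 2]. *)
have e0 : 0 < r / 2 / (1 + eps) by rewrite divr_gt0// ltr_pwDl.
have [W [n [Wn VW]]] := Lspace_bounded_approx V e0.
have v0 : 0 < 1 + `|V| by rewrite ltr_pwDl.
pose dl := r / 2 / (1 + `|V|); have dl0 : 0 < dl by rewrite divr_gt0.
(* The constant dominates [eps * n], hence [eps *: W]; the summand 1 keeps it positive. *)
exists (Y0 + l0 *: V), (1 + eps * `|n|), dl; split=> //.
- by rewrite ltr_pwDl// mulr_ge0.
- by move=> l; rewrite -addrA -scalerDl => /l0min; rewrite lerDl.
(* This element equals [Y0 - eps *: (V - W) - dl *: V], which lies in the ball of radius [r] around
   [Y0]. *)
have [_ _ mono] := hA; apply: (mono (Y0 + l0 *: V - dl *: V + eps *: W)).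
  apply: rA.
  rewrite (_ : Y0 - _ = eps *: (V - W) + dl *: V); last first.
    rewrite !opprD opprK !addrA subrr add0r -(scaleNr l0) -/eps.
    by rewrite scalerBr addrAC.
  rewrite (le_lt_trans (ler_normD _ _))// [ltRHS]splitr.
  rewrite ltr_leD//.
    rewrite normrZ ger0_norm//.
    move: VW; rewrite ltr_pdivlMr ?ltr_pwDl//; apply: le_lt_trans.
    by rewrite mulrC ler_wpM2l// lerDr.
  rewrite normrZ gtr0_norm// /dl mulrAC ler_pdivrMr// ler_pM2l//.
  by rewrite lerDr.
rewrite [X in Lspace_le _ X]addrAC; apply: Lspace_leDl.
apply: (@Lspace_leT _ _ _ _ _ _ _ (eps *: Lspace_cst P p1 n)).
  exact: Lspace_leZ.
rewrite Lspace_cstZ; apply: Lspace_cst_le.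
by rewrite (le_trans (ler_wpM2l eps0 (ler_norm n)))// lerDr.
Qed.

End acceptance_boundary.

(** * From the boundary point to continuity of the pricing functional *)

Theorem proposition5p13 (d : measure_display) (T : measurableType d)
    (R : realType) (P : probability T R) (hP : nonatomic P)
    (p : \bar R) (p1 : (1 <= p)%E) (A : set (LspaceType P p1))
    (hA : acceptance_set A) (Aclosed : closed A)
    (Aconvex : convex_set (A : set (convex_lmodType (LspaceType P p1))))
    (Aint : interior A !=set0)
    (S : traded_asset P p1) (f : R -> R) (hf : pricing_functional S f)
    (hsub : cash_subadditive (rho_pricing A S f))
    (hfin : rho A S 0 \is a fin_num) :
  continuous f.
Proof.
have [fincr _ _] := hf; have [_ sub] := hsub.
have fmono : {mono f : x y / x <= y} by exact: le_mono.
have [Y [c [dl [c0 dl0 AY Ymin Yc]]]] :=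
  acceptance_boundary hA Aclosed Aconvex Aint hfin.
set V := asset_payoff S in Ymin Yc.
have lip x t : 0 < t <= 1 -> f x - t * c <= f (x - t * dl).
  move=> /andP[t0 t1].
  (* By minimality of [Y], only [l >= x] units bring [Y - x *: V] back into [A]. *)
  have lo : ((f x)%:E <= rho_pricing A S f (Y + (- x) *: V)%R)%E.
    apply/ereal_infP => _ [l /= Al <-]; rewrite lee_fin fmono.
    by move: Al; rewrite -addrA -scalerDl => /Ymin; rewrite addrC subr_ge0.
  (* With [x - t * dl] units the position becomes [Y + t *: (c - dl *: V)], [c] read as a constant
     function: a point of the segment from [Y] given by [Yc]. *)
  have up : (rho_pricing A S f (Y + (- x) *: V + Lspace_cst P p1 (t * c))%R
             <= (f (x - t * dl))%:E)%E.
    apply: ereal_inf_lbound; exists (x - t * dl) => //=; rewrite -/V.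
    have := @convex_set_segment R (LspaceType P p1) A Y _ t Aconvex AY Yc.
    rewrite (ltW t0) t1 => /(_ isT).
    congr (A _); rewrite -Lspace_cstZ.
    rewrite -[Y + _ - _]addrA [_ - Y]addrAC subrr add0r.
    rewrite scalerBr scalerA scalerBl scaleNr.
    by rewrite !addrA [Y - _ + _]addrAC addrNK.
  have tc0 : 0 < t * c by rewrite mulr_gt0.
  rewrite -lee_fin EFinB; apply: le_trans up.
  by apply: le_trans (sub _ _ tc0); rewrite leeD2r.
move=> x; apply/cvgrPdist_lt => e e0.
pose t := Num.min 1 (e / 2 / c).
have t0 : 0 < t by rewrite lt_min ltr01 !divr_gt0.
have t1 : t <= 1 by rewrite ge_min lexx.
have tc : t * c < e.
  apply: (@le_lt_trans _ _ (e / 2)).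
    by rewrite -ler_pdivlMr// ge_min lexx orbT.
  by rewrite ltr_pdivrMr// ltr_pMr// ltr1n.
have t01 : 0 < t <= 1 by rewrite t0 t1.
have h0 : 0 < t * dl by rewrite mulr_gt0.
apply/nbhs_normP; exists (t * dl) => //= y /=.
rewrite ltr_distl => /andP[xy yx].
(* Applied at [x] and at [x + t * dl], [lip] bounds [f] from below at [x - t * dl] and from above at
   [x + t * dl]; monotonicity covers the points between. *)
have := lip x t t01; have := lip (x + t * dl) t t01; rewrite addrK => up lo.
have fy : f y <= f (x + t * dl) by rewrite fmono ltW// -ltrBlDr.
have yf : f (x - t * dl) <= f y by rewrite fmono ltW// ltrBlDr.
rewrite ltr_distl; lra.
Qed.
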